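(* Let $S\subseteq\mathbb{N}$ be a numerical semigroup with multiplicity $m$ and conductor $c$, and suppose $q(S)=\lceil c/m\rceil=3$ (equivalently $2m<c\le 3m$). Then $S$ satisfies Wilf's conjecture, i.e. $e(S)\,|L(S)|\ge c(S)$.
   Context: $\mathbb{N}=\{0,1,2,\dots\}$. A numerical semigroup is a subset $S\subseteq\mathbb{N}$ closed under addition, containing $0$, with finite complement in $\mathbb{N}$. Its multiplicity is $m=\min(S\setminus\{0\})$; its conductor is $c=c(S)=\max(\mathbb{N}\setminus S)+1$; $L(S)=\{s\in S : s<c\}$; its embedding dimension $e(S)$ is the least number of elements generating $S$ as a semigroup (additive monoid). *)

(* Defs.v *)
From mathcomp Require Import all_boot all_order all_algebra finmap.
From mathcomp Require Import mathcomp_extra boolp classical_sets functions.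
From mathcomp Require Import cardinality.

Set Implicit Arguments.
Unset Strict Implicit.
Unset Printing Implicit Defensive.

Local Open Scope classical_set_scope.
Local Open Scope nat_scope.

Definition submonoid (M : set nat) : Prop :=
  M 0 /\ (forall x y, M x -> M y -> M (x + y)).

Definition numerical_semigroup (S : set nat) : Prop :=
  submonoid S /\ finite_set (~` S).

(* The default value 0 is only returned when A is empty. *)
Definition least (A : set nat) : nat :=
  xget 0 [set n | A n /\ forall k, A k -> n <= k].

Lemma leastP (A : set nat) :
  A !=set0 -> A (least A) /\ forall k, A k -> least A <= k.
Proof.
move=> [n An].
apply: (@xgetPex _ 0 [set n | A n /\ forall k, A k -> n <= k]).
have exA : exists i, `[< A i >] by exists n; apply/asboolP.
case: (ex_minnP exA) => i /asboolP Ai imin.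
by exists i; split=> // k Ak; apply/imin/asboolP.
Qed.

Definition multiplicity (S : set nat) : nat := least (S `\ 0).

(* For S = nat there is no gap and the big max gives 0, i.e. the usual
   convention that the maximum of the empty set is -1. *)
Definition conductor (S : set nat) : nat :=
  \max_(g <- fset_set (~` S)) g.+1.

Definition depth (S : set nat) : int :=
  Num.ceil ((conductor S)%:Q / (multiplicity S)%:Q)%R.

Definition left_part (S : set nat) : set nat :=
  [set s | S s /\ s < conductor S].

(* fset_set is junk on infinite sets, hence this check. *)
Lemma finite_left_part (S : set nat) : finite_set (left_part S).
Proof. by apply: sub_finite_set (finite_II (conductor S)) => s []. Qed.

Definition generated (A : set nat) : set nat := smallest submonoid A.

Definition embdim (S : set nat) : nat :=
  least [set n | exists A : {fset nat},
                   #|` A|%fset = n /\ generated [set` A] = S].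

Lemma conductorP (S : set nat) n :
  finite_set (~` S) -> conductor S <= n -> S n.
Proof.
move=> finS cn; apply: contrapT => nSn.
suff : n.+1 <= conductor S by rewrite ltnNge cn.
rewrite /conductor (big_rem n) ?leq_maxl //=.
by rewrite in_fset_set // inE.
Qed.

(* Numerical semigroups are finitely generated, so the set whose least
   element defines embdim S is nonempty. *)
Lemma numerical_semigroup_fg (S : set nat) : numerical_semigroup S ->
  exists A : {fset nat}, generated [set` A] = S.
Proof.
move=> [[S0 SD] finS].
have Sbig n : conductor S <= n -> S n by exact: conductorP.
set c := conductor S in Sbig.
pose B := [set s | S s /\ s < c.+1 + c.+1].
have finB : finite_set B.
  by apply: sub_finite_set (finite_II (c.+1 + c.+1)) => s [].
exists (fset_set B); rewrite fset_setK //; apply/seteqP; split=> [x|x Sx].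
  by apply; split=> // s [].
move=> M [[M0 MD] BM].
elim/ltn_ind: x Sx => x IH Sx.
case: (ltnP x (c.+1 + c.+1)) => xc; first by apply: BM.
have cx : c.+1 <= x by apply: leq_trans xc; rewrite leq_addr.
rewrite -(subnK cx); apply: MD.
  apply: IH; first by rewrite ltn_subrL (leq_trans _ cx).
  by apply: Sbig; rewrite leq_subRL // (leq_trans _ xc) // leq_add2l.
apply: BM; split; first exact: Sbig.
by rewrite addnS ltnS leq_addr.
Qed.

(* Main.v *)
Require Import Defs.
From mathcomp Require Import all_boot all_order all_algebra finmap.
From mathcomp Require Import mathcomp_extra boolp classical_sets functions.
From mathcomp Require Import cardinality.
From mathcomp Require Import zify.

(* Cut the integers into I1 = [c-2m, c-m[, I2 = [c-m, c[ and I3 = [c, c+m[, and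
   let A be the Apery elements of I1 (all primitive), B and D the primitive and
   the decomposable Apery elements of I2, Q and P3 those of I3, primitive ones
   in P3.  With small letters for cardinals and r = 3m - c, one has
   m = 1 + a + b + h + p + q (h = |D|, p = |P3|, q = |Q|), there are
   3 + 2a + b + h left elements, and at least 1 + a + b + p primitive ones, so
   it remains to bound q.  By size considerations, every element of Q lies in
   A + A, A + B, B + B or A + A + A.  These contribute e11, e12, e22 and t
   elements, where
     2 (h + e11) <= a (a + 1),   e12 <= a b,
     2 e22 <= b (b + 1) and e22 <= r  (since B + B starts at 2 (c - m)),
     6 t <= 2 (a + 1) h + a (a + 1),
   and Wilf's inequality follows by a linear combination.  The bound on t is
   elementary double counting and replaces Macaulay's theorem. *)

Set Implicit Arguments.
Unset Strict Implicit.
Unset Printing Implicit Defensive.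

Import GRing.Theory Num.Theory.

(** * Counting tools, up to sums of three elements *)

Lemma size_le_rel (U V : eqType) (r : U -> V -> bool)
    (s1 : seq U) (s2 : seq V) :
    uniq s1 -> {in s1, forall t, exists2 h, h \in s2 & r t h} ->
    {in s1 &, forall t t' h, r t h -> r t' h -> t = t'} ->
  size s1 <= size s2.
Proof.
case: s1 => [//|t0 s] us rex rfun; set s1 := t0 :: s in us rex rfun *.
(* [g] maps h to the first entry of [s1] related to it; by [rfun] its image covers [s1], so no
   injection has to be chosen. *)
pose g h := nth t0 s1 (find (r^~ h) s1).
rewrite -(size_map g s2); apply: uniq_leq_size => // t ts.
have [h hs2 rth] := rex t ts; apply/mapP; exists h => //.
have hasr : has (r^~ h) s1 by apply/hasP; exists t.
apply: (rfun t _ ts _ h rth) (nth_find t0 hasr).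
by rewrite mem_nth // -has_find.
Qed.

(** Only unordered pairs matter: each new z in A adds just the row of values f z y to the list. *)
Lemma size_sym_image (f : nat -> nat -> nat) (A s : seq nat) :
    (forall x y, f x y = f y x) -> uniq s ->
    {in s, forall t, exists x y, [/\ x \in A, y \in A & t = f x y]} ->
  2 * size s <= size A * (size A).+1.
Proof.
move=> fC us sA.
suff [l lsz lA] : exists2 l, 2 * size l = size A * (size A).+1 &
    {in A &, forall x y, f x y \in l}.
  rewrite -lsz leq_mul2l; apply: uniq_leq_size => // t /sA[x [y [xA yA ->]]].
  exact: lA.
elim: A {s us sA} => [|z A [l lsz lA]]; first by exists [::].
exists ([seq f z y | y <- z :: A] ++ l).
  by rewrite size_cat size_map /= mulnDr lsz; nia.
have hz y : y \in z :: A -> f z y \in [seq f z y | y <- z :: A] by exact: map_f.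
move=> x y xzA yzA; rewrite mem_cat; apply/orP.
have [->|xz] := eqVneq x z; first by left; apply: hz.
have [->|yz] := eqVneq y z; first by left; rewrite fC; apply: hz.
by right; move: xzA yzA; rewrite !inE (negPf xz) (negPf yz); apply: lA.
Qed.

(* Let F t be the set of x in A with t - x in D, so that the cardinals of the
   F t add up to at most |A| |D|.  If F t has fewer than three elements, then t
   has a unique expression 2 x + z.  The defect 3 - |F t| is then charged to the
   element x + z of D if x <= z, to the unordered pair {x, z} if z <= x, and to
   both if x = z. *)
Section TripleSums.
Variables A D T : seq nat.
Hypothesis uT : uniq T.
Hypothesis TA : {in T, forall t, exists u v w,
  [/\ u \in A, v \in A, w \in A & t = u + v + w]}.
Hypothesis TD : forall u v w, u \in A -> v \in A -> w \in A ->
  u + v + w \in T -> u + v \in D.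

Let F t := [seq x <- A | (x <= t) && (t - x \in D)].

Let memF u v w : u \in A -> v \in A -> w \in A -> u + v + w \in T ->
  w \in F (u + v + w).
Proof.
move=> uA' vA wA tT; rewrite mem_filter wA leq_addl addnK andbT /=.
exact: TD tT.
Qed.

Let size_F t l : uniq l -> {subset l <= F t} -> size l <= size (F t).
Proof. exact: uniq_leq_size. Qed.

Let low t := has (fun x => has (fun z => (x <= z) && (t == x + x + z)) A) A.
Let high t := has (fun x => has (fun z => (z <= x) && (t == x + x + z)) A) A.
Let T1 := [seq t <- T | (size (F t) <= 2) && low t].
Let T2 := [seq t <- T | high t].

Let sum_F : \sum_(t <- T) size (F t) <= size A * size D.
Proof.
under eq_bigr do rewrite size_filter -sum1_count.
under eq_bigr do rewrite big_mkcond.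
rewrite exchange_big /= mulnC -[size A]sum1_size big_distrr /=.
rewrite !big_seq; apply: leq_sum => x xA; rewrite muln1.
(* For fixed x in A, every t with x in F t lies in x + D. *)
rewrite -big_mkcond sum1_count -size_filter -(size_map (addn x) D).
apply: uniq_leq_size => [|t]; first exact: filter_uniq.
rewrite mem_filter => /andP[/andP[xt tD] _].
by apply/mapP; exists (t - x); rewrite ?subnKC.
Qed.

Let size_T1 : size T1 <= size D.
Proof.
pose r t h := has (fun x => has (fun z =>
  [&& x <= z, t == x + x + z & h == x + z]) A) A.
apply: (@size_le_rel _ _ r); first exact: filter_uniq.
  move=> t; rewrite mem_filter => /andP[/andP[_ lowt] tT].
  case/hasP: lowt => x xA /hasP[z zA /andP[xz /eqP tE]].
  exists (x + z); first by apply: (@TD x z x) => //; rewrite addnAC -tE.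
  by apply/hasP; exists x => //; apply/hasP; exists z; rewrite ?xz ?tE ?eqxx.
move=> t t' + _ h; rewrite mem_filter => /andP[/andP[Ft _] tT].
case/hasP=> x xA /hasP[z zA /and3P[xz /eqP tE /eqP hE]].
case/hasP=> x' x'A /hasP[z' z'A /and3P[xz' /eqP t'E /eqP hE']].
have memFt u v w : u \in A -> v \in A -> w \in A -> t = u + v + w -> w \in F t.
  by move=> uA' vA wA E; rewrite E; apply: memF; rewrite -?E.
have xF : x \in F t by apply: (memFt x z x) => //; lia.
have zF : z \in F t by apply: (memFt x x z) => //; lia.
(* Since x + z = x' + z', also t = x + x' + z'. If x and x' differed, F t would have three
   elements. *)
have x'F : x' \in F t by apply: (memFt x z' x') => //; lia.
have z'F : z' \in F t by apply: (memFt x x' z') => //; lia.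
suff : x = x' by lia.
apply/eqP; apply: contraTT Ft => xx'; rewrite -ltnNge.
have [xz_eq|xz_neq] := eqVneq x z.
  apply: (@size_F t [:: x; x'; z']); first by rewrite /= !inE; lia.
  by apply/allP; rewrite /= xF x'F z'F.
apply: (@size_F t [:: x; z; x']); first by rewrite /= !inE; lia.
by apply/allP; rewrite /= xF x'F zF.
Qed.

Let size_T2 : 2 * size T2 <= size A * (size A).+1.
Proof.
(* For z <= x, the sum 2 x + z is x + z + max(x, z), which is symmetric in x and z. *)
apply: (@size_sym_image (fun x y => x + y + maxn x y)).
- by move=> x y; lia.
- exact: filter_uniq.
move=> t; rewrite mem_filter => /andP[/hasP[x xA /hasP[z zA /andP[zx /eqP ->]]] _].
by exists x, z; split=> //; lia.
Qed.

Let three_le t : t \in T ->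
  3 <= size (F t) + ((size (F t) <= 2) && low t) + high t.
Proof.
move=> tT; have [F3|F2] := ltnP 2 (size (F t)); first by lia.
(* F t contains x and z. If they differ, [low] or [high] supplies the third unit; if they agree,
   both hold. *)
have dbl x z : x \in A -> z \in A -> t = x + x + z ->
    3 <= size (F t) + low t + high t.
  move=> xA zA tE.
  have xF : x \in F t.
    by rewrite tE addnAC; apply: memF => //; rewrite addnAC -tE.
  have zF : z \in F t by rewrite tE; apply: memF => //; rewrite -tE.
  have lo : x <= z -> low t.
    by move=> xz; apply/hasP; exists x => //; apply/hasP; exists z; rewrite ?xz ?tE /=.
  have hi : z <= x -> high t.
    by move=> xz; apply/hasP; exists x => //; apply/hasP; exists z; rewrite ?xz ?tE /=.
  have F1 : 1 <= size (F t) by case: (F t) xF.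
  have F2' : x != z -> 2 <= size (F t).
    move=> xz; apply: (@size_F t [:: x; z]); first by rewrite /= inE xz.
    by apply/allP; rewrite /= xF zF.
  by lia.
have [u [v [w [uA' vA wA tE]]]] := TA tT.
have [uv|uv] := eqVneq u v; first by apply: (dbl u w) => //; lia.
have [uw|uw] := eqVneq u w; first by apply: (dbl u v) => //; lia.
have [vw|vw] := eqVneq v w; first by apply: (dbl v u) => //; lia.
suff : 3 <= size (F t) by lia.
apply: (@size_F t [:: u; v; w]); first by rewrite /= !inE (negPf uv) (negPf uw) vw.
have memFt x y z : x \in A -> y \in A -> z \in A -> t = x + y + z -> z \in F t.
  by move=> xA yA zA E; rewrite E; apply: memF; rewrite -?E.
by apply/allP; rewrite /= (memFt v w u) ?(memFt u w v) ?(memFt u v w) //; lia.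
Qed.

(** Summing [three_le] over T gives 3 |T| <= |A| |D| + |T1| + |T2|. *)
Lemma size_triple_sums :
  6 * size T <= 2 * ((size A).+1 * size D) + size A * (size A).+1.
Proof.
have : \sum_(t <- T) 3 <= \sum_(t <- T)
    (size (F t) + ((size (F t) <= 2) && low t) + high t).
  by rewrite !big_seq; apply: leq_sum => t; exact: three_le.
have cnt (p : pred nat) : \sum_(t <- T) p t = count p T.
  by rewrite -sum1_count [RHS]big_mkcond.
rewrite !big_split /= !cnt -!size_filter big_const_seq iter_addn_0 count_predT.
move: sum_F size_T1 size_T2; rewrite -/T1 -/T2 (mulSn (size A) (size D)).
move: (size T1) (size T2) (\sum_(t <- T) _) (size A * size D) => k1 k2 S k.
move: (size A * _) => k'; lia.
Qed.

End TripleSums.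

Lemma count_partition (U : eqType) (P Q R : pred U) (l : seq U) :
  {in l, forall x, P x = Q x + R x :> nat} ->
  count P l = count Q l + count R l.
Proof.
elim: l => //= x l IH PE; rewrite PE ?mem_head // IH; first by lia.
by move=> y yl; apply: PE; rewrite inE yl orbT.
Qed.

Ltac nat_lia :=
  repeat match goal with H : ?P |- _ =>
    lazymatch P with
    | nat => fail
    | is_true (leq _ _) => fail
    | is_true (leq _ _ && leq _ _) => fail
    | is_true (~~ (_ == _)) => fail
    | _ = _ => fail
    | _ => clear H
    end
  end; lia.

(** * Apery elements in three windows of length m *)

Section DepthThree.
Variables (s : pred nat) (m c : nat).
Hypotheses (s0 : s 0) (sD : forall x y, s x -> s y -> s (x + y)).
Hypotheses (sm : s m) (m_min : forall x, 0 < x -> s x -> m <= x).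
Hypotheses (c_gt : 2 * m < c) (c_le : c <= 3 * m).
Hypothesis (sc : forall x, c <= x -> s x).

Definition decomposable (x : nat) :=
  has (fun u => [&& 0 < u, u < x, s u & s (x - u)]) (iota 0 x).

(** These are the minimal generators of the semigroup. *)
Definition primitive_elt (x : nat) := [&& 0 < x, s x & ~~ decomposable x].

(** The Apery set of m. The guard m <= x matters: for x < m, truncated subtraction gives x - m = 0,
    which is in s. *)
Let ap x := s x && ~~ ((m <= x) && s (x - m)).

Let decP x : decomposable x ->
  exists u v, [/\ 0 < u, 0 < v, s u, s v & x = u + v].
Proof.
case/hasP=> u _ /and4P[u0 ux su sv]; exists u, (x - u).
by split=> //; nat_lia.
Qed.

Let decI u v : 0 < u -> 0 < v -> s u -> s v -> decomposable (u + v).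
Proof.
move=> u0 v0 su sv; apply/hasP; exists u; first by rewrite mem_iota; nat_lia.
by rewrite u0 su addKn sv; nat_lia.
Qed.

(** If u - m were in s, so would be u + v - m = (u - m) + v. *)
Let ap_sum u v : ap (u + v) -> s u -> s v -> ap u.
Proof.
case/andP=> _ nap su sv; rewrite /ap su /=; apply: contra nap => /andP[mu sum].
by rewrite -addnBAC // sD // andbT; nat_lia.
Qed.

Let ap_gt u : 0 < u -> ap u -> m < u.
Proof.
move=> u0 /andP[su nap]; have := m_min u0 su; rewrite leq_eqVlt.
by case/predU1P=> // mu; move: nap; rewrite -mu leqnn subnn s0.
Qed.

Let ap_dec x : ap x -> decomposable x ->
  exists u v, [/\ m < u, m < v, ap u, ap v & x = u + v].
Proof.
move=> apx /decP[u [v [u0 v0 su sv xE]]].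
have apu : ap u by apply: (@ap_sum u v) => //; rewrite -xE.
have apv : ap v by apply: (@ap_sum v u) => //; rewrite addnC -xE.
by exists u, v; split=> //; apply: ap_gt.
Qed.

Let I1 := iota (c - 2 * m) m.
Let I2 := iota (c - m) m.
Let I3 := iota c m.

Let memI1 x : (x \in I1) = (c - 2 * m <= x < c - m).
Proof. by rewrite mem_iota; nat_lia. Qed.
Let memI2 x : (x \in I2) = (c - m <= x < c).
Proof. by rewrite mem_iota; nat_lia. Qed.
Let memI3 x : (x \in I3) = (c <= x < c + m).
Proof. by rewrite mem_iota. Qed.

Let A := filter ap I1.
Let D := filter (predI ap decomposable) I2.
Let B := filter primitive_elt I2.
Let Q := filter (predI ap decomposable) I3.
Let P3 := filter primitive_elt I3.

Let uD : uniq D. Proof. by rewrite filter_uniq ?iota_uniq. Qed.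
Let uQ : uniq Q. Proof. by rewrite filter_uniq ?iota_uniq. Qed.

Let memA x : m < x -> ap x -> x < c - m -> x \in A.
Proof. by move=> mx apx xc; rewrite mem_filter apx memI1; nat_lia. Qed.

Let A_gt x : x \in A -> m < x < c - m.
Proof.
rewrite mem_filter memI1 => /andP[apx xI].
by have := @ap_gt x; rewrite apx; nat_lia.
Qed.

Let memB x : c - m <= x < c -> ap x -> ~~ decomposable x -> x \in B.
Proof.
move=> xI /andP[sx _] ndx; rewrite mem_filter memI2 xI andbT.
by rewrite /primitive_elt sx ndx; nat_lia.
Qed.

(** If x - m is in s, then m < x makes x = m + (x - m) decomposable. *)
Let prim_ap x : m < x -> primitive_elt x = ap x && ~~ decomposable x.
Proof.
move=> mx; rewrite /primitive_elt /ap; have -> : 0 < x by nat_lia.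
case sx: (s x) => //=; case nd: (decomposable x) => /=; first by rewrite andbF.
rewrite andbT; apply/esym; apply: contraFN nd => /andP[_ sxm].
by rewrite -(subnKC (ltnW mx)); apply: decI => //; nat_lia.
Qed.

(** Both summands exceed m and their sum is below c, so both are below c - m. *)
Let D_sum h : h \in D -> exists u v, [/\ u \in A, v \in A & h = u + v].
Proof.
rewrite mem_filter memI2 => /andP[/andP[aph dech] hI].
have [u [v [mu mv apu apv hE]]] := ap_dec aph dech.
by exists u, v; split=> //; apply: memA => //; nat_lia.
Qed.

Let T := [seq t <- Q | has (fun u => has (fun v => has (fun w =>
  t == u + v + w) A) A) A].
Let E11 := [seq t <- Q | has (fun u => has (fun v => t == u + v) A) A].
Let E12 := [seq t <- Q | has (fun u => has (fun v => t == u + v) B) A].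
Let E22 := [seq t <- Q | has (fun u => has (fun v => t == u + v) B) B].

Let size_T : 6 * size T <= 2 * ((size A).+1 * size D) + size A * (size A).+1.
Proof.
apply: size_triple_sums => //; first by rewrite filter_uniq.
  move=> t; rewrite mem_filter => /andP[/hasP[u uA' /hasP[v vA /hasP[w wA /eqP ->]]] _].
  by exists u, v, w.
(* From w > m and t < c + m comes u + v < c, and u + v > 2 m >= c - m; so u + v is in I2, and it is
   Apery as a summand of t. *)
move=> u v w uA' vA wA; rewrite mem_filter => /andP[_].
rewrite mem_filter memI3 => /andP[/andP[apt _] tI].
have [uI vI wI] := And3 (A_gt uA') (A_gt vA) (A_gt wA).
have sA x : x \in A -> s x by rewrite mem_filter => /andP[/andP[]].
rewrite mem_filter memI2 /= decI ?sA //; try nat_lia.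
by rewrite (ap_sum apt) ?sD ?sA //; nat_lia.
Qed.

(** D and E11 are disjoint, lying in I2 and I3, and consist of sums from A + A, so they share one
    bound. *)
Let size_E11 : 2 * (size D + size E11) <= size A * (size A).+1.
Proof.
rewrite -size_cat; apply: (@size_sym_image addn); first exact: addnC.
  rewrite cat_uniq uD filter_uniq // andbT; apply/hasPn => t.
  rewrite mem_filter => /andP[_]; rewrite !mem_filter memI2 memI3 => /andP[_ tI].
  by apply/negP => /andP[_]; nat_lia.
move=> t; rewrite mem_cat => /orP[/D_sum//|].
rewrite mem_filter => /andP[/hasP[u uA' /hasP[v vA /eqP tE]] _].
by exists u, v.
Qed.

Let size_E22 : 2 * size E22 <= size B * (size B).+1.
Proof.
apply: (@size_sym_image addn); [exact: addnC | exact: filter_uniq | move=> t].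
rewrite mem_filter => /andP[/hasP[u uB' /hasP[v vB /eqP tE]] _].
by exists u, v.
Qed.

Let size_E22_le : size E22 <= 3 * m - c.
Proof.
(* E22 lies in [2 (c - m), c + m[, which has 3 m - c elements. *)
rewrite -(size_iota (2 * (c - m)) (3 * m - c)).
apply: uniq_leq_size => [|t]; first exact: filter_uniq.
rewrite mem_filter => /andP[/hasP[u + /hasP[v + /eqP tE]]].
rewrite !mem_filter !memI2 memI3 mem_iota => /andP[_ uI] /andP[_ vI] /andP[_ tI].
nat_lia.
Qed.

Let size_E12 : size E12 <= size A * size B.
Proof.
rewrite -(size_allpairs addn); apply: uniq_leq_size => [|t].
  exact: filter_uniq.
rewrite mem_filter => /andP[/hasP[u uA' /hasP[v vB /eqP ->]] _].
by apply/allpairsP; exists (u, v).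
Qed.

Let size_Q : size Q <= size E11 + size E12 + size E22 + size T.
Proof.
rewrite -!size_cat; apply: uniq_leq_size => // t tQ.
have := tQ; rewrite mem_filter memI3 => /andP[/andP[apt dect] tI].
have [u [v [mu mv apu apv tE]]] := ap_dec apt dect.
rewrite !mem_cat !(mem_filter _ _ Q) tQ !andbT.
wlog uv : u v mu mv apu apv tE / u <= v.
  by move=> H; case: (leqP u v) => [|/ltnW] uv; [apply: (H u v)|apply: (H v u)]; rewrite // addnC.
have has2 (X Y : seq nat) : u \in X -> v \in Y ->
    has (fun u => has (fun v => t == u + v) Y) X.
  by move=> uX vY; apply/hasP; exists u => //; apply/hasP; exists v; rewrite ?tE.
have has3 x y z : x \in A -> y \in A -> z \in A -> t = x + y + z ->
    has (fun u => has (fun v => has (fun w => t == u + v + w) A) A) A.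
  move=> xA yA zA E; apply/hasP; exists x => //; apply/hasP; exists y => //.
  by apply/hasP; exists z; rewrite ?E.
have [vA|vA] := ltnP v (c - m).
  by rewrite (has2 A A) // memA //; nat_lia.
(* A decomposable v exceeds 2 m, which leaves u < c - m, so t is in A + A + A. *)
have [decv|ndecv] := boolP (decomposable v).
  have [x [y [mx my apx apy vE]]] := ap_dec apv decv.
  by rewrite (has3 u x y) ?orbT // ?memA //; nat_lia.
have vB : v \in B by apply: memB => //; nat_lia.
have [uA'|uA'] := ltnP u (c - m).
  by rewrite (has2 A B) ?orbT // memA //; nat_lia.
have [decu|ndecu] := boolP (decomposable u).
  (* This case is void: u > 2 m would force v < c - m. *)
  have [x [y [mx my apx apy uE]]] := ap_dec apu decu.
  by rewrite (has3 x y v) ?orbT // ?memA //; nat_lia.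
by rewrite (has2 B B) ?orbT // memB //; nat_lia.
Qed.

(** I1 contains m and lies below 2 m, so for x >= m in I1, x - m is in s only if x = m. The
    successor counts m. *)
Let count_I1 : count s I1 = (size A).+1.
Proof.
rewrite (@count_partition _ _ (pred1 m) ap) => [|x].
  rewrite count_uniq_mem ?iota_uniq // memI1 /A size_filter.
  by have -> : c - 2 * m <= m < c - m by nat_lia.
rewrite memI1 /ap /= => xI; have [->|xm] := eqVneq x m.
  by rewrite leqnn subnn s0 sm.
suff /negPf -> : ~~ ((m <= x) && s (x - m)) by rewrite andbT.
by apply/negP => /andP[mx sxm]; have := m_min _ sxm; nat_lia.
Qed.

(** A sum of two positive elements of s is at least 2 m >= c - m, hence beyond I1. *)
Let count_prim_I1 : count primitive_elt I1 = (size A).+1.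
Proof.
rewrite -count_I1; apply: eq_in_count => x; rewrite memI1 /primitive_elt => xI.
have -> : 0 < x by nat_lia.
case sx: (s x) => //=; apply/negP => /decP[u [v [u0 v0 su sv xE]]].
by have := m_min u0 su; have := m_min v0 sv; nat_lia.
Qed.

(** An element of s in the shifted window is either a translate by m of one in the first window or
    Apery. As k > 0, the shifted window lies above m, where [prim_ap] applies. *)
Let count_shift k : 0 < k -> count s (iota (m + k) m) = count s (iota k m) +
  (count primitive_elt (iota (m + k) m) +
   count (predI ap decomposable) (iota (m + k) m)).
Proof.
move=> k0; rewrite -(@count_partition _ ap) => [|x]; last first.
  rewrite mem_iota => xk; rewrite prim_ap /=; last by nat_lia.
  by case: (ap x); case: (decomposable x).
rewrite !iotaDl !count_map; apply: count_partition => x; rewrite mem_iota => xk.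
rewrite /= /ap leq_addr addKn /=; case sx: (s x); last by rewrite andbT.
by rewrite sD.
Qed.

Let count_I2 : count s I2 = (size A).+1 + (size B + size D).
Proof.
have -> : I2 = iota (m + (c - 2 * m)) m by rewrite /I2; congr iota; nat_lia.
rewrite count_shift; last by nat_lia.
rewrite -/I1 count_I1 /B /D !size_filter /I2.
by have -> : c - m = m + (c - 2 * m) by nat_lia.
Qed.

Let count_I3 : m = count s I2 + (size P3 + size Q).
Proof.
have := @count_shift (c - m); rewrite (_ : m + (c - m) = c); last by nat_lia.
rewrite /P3 /Q !size_filter => <-; last by nat_lia.
rewrite -{1}(size_iota c m); apply/esym/eqP; rewrite -all_count.
by apply/allP => x; rewrite mem_iota => /andP[/sc].
Qed.

Lemma wilf_depth3 :
  c <= count primitive_elt (iota 0 (c + m)) * count s (iota 0 c).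
Proof.
have -> : c + m = (c - 2 * m) + (m + (m + m)) by nat_lia.
have -> : iota 0 c = iota 0 (c - 2 * m) ++ I1 ++ I2.
  rewrite /I2 (_ : c - m = c - 2 * m + m); last by nat_lia.
  by rewrite -!iotaD; congr iota; nat_lia.
rewrite !iotaD !count_cat add0n -/I1.
rewrite (_ : c - 2 * m + m = c - m); last by nat_lia.
rewrite (_ : c - m + m = c) -/I2 -/I3; last by nat_lia.
(* 0 lies below I1 and supplies one more left element. *)
have L0 : 0 < count s (iota 0 (c - 2 * m)).
  by rewrite -has_count; apply/hasP; exists 0; rewrite // mem_iota; nat_lia.
rewrite count_I1 count_prim_I1 count_I2 -[count _ I2]size_filter -/B.
rewrite -[count _ I3]size_filter -/P3.
move: count_I3 size_Q size_T size_E11 size_E22 size_E22_le size_E12.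
rewrite count_I2.
move: (size A) (size B) (size D) (size Q) (size P3) (size T) => a b h d p t.
move: (size E11) (size E12) (size E22) => e11 e12 e22.
move: L0; move: (count s (iota 0 (c - 2 * m))) => l0.
move: (count primitive_elt (iota 0 (c - 2 * m))) => p0 L0.
move=> mE dE tE e11E e22E e22_le e12E.
(* Here [d] is |Q|, and c = 3 m - r. In 3 |Q| - r one e22 cancels against r; the other two, 3 (h +
   e11), 3 e12 and 3 t are bounded by the hypotheses. The right side exceeds the outcome by b h + p
   (2 a + b + h). *)
have : c <= (a.+1 + (b + p)) * (1 + (a.+1 + (a.+1 + (b + h)))).
  move: tE e11E e22E e12E.
  rewrite !(mulnDl, mulnDr, mulSn, mulnS, mul0n, muln1) (mulnC b a).
  nat_lia.
move=> /leq_trans; apply; apply: leq_mul; nat_lia.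
Qed.

End DepthThree.

(** * Back to sets: embedding dimension, left part and depth *)

Lemma size_le_card_fset_set (l : seq nat) (A : set nat) :
  uniq l -> finite_set A -> (forall x, x \in l -> A x) ->
  size l <= #|` fset_set A|%fset.
Proof.
by move=> ul finA lA; apply: uniq_leq_size => // x /lA; rewrite in_fset_set ?inE.
Qed.

(** Removing a primitive x from S leaves a submonoid. Were x not in A, that submonoid would contain
    A, hence all of S. *)
Lemma generated_primitive (S A : set nat) (x : nat) :
  submonoid S -> generated A = S ->
  primitive_elt (fun y => `[< S y >]) x -> A x.
Proof.
move=> [S0 SD] genA /and3P[x0 /asboolP Sx ndx]; apply: contrapT => nAx.
have AS : (A `<=` S)%classic by rewrite -genA; exact: sub_smallest.
suff [_ /(_ erefl)] : (S `\ x)%classic x by [].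
rewrite -{1}genA in Sx; apply: Sx; split; last first.
  by move=> y Ay; split; [exact: AS | move=> /= yx; apply: nAx; rewrite -yx].
split; first by split=> //= x0'; rewrite -x0' in x0.
move=> y z [Sy yx] [Sz zx]; split; first exact: SD.
move=> /= yzx; move/hasP: ndx; apply.
have y0 : y <> 0 by move=> y0; apply: zx; rewrite /= -yzx y0.
have z0 : z <> 0 by move=> z0; apply: yx; rewrite /= -yzx z0 addn0.
exists y; first by rewrite mem_iota; lia.
by rewrite -yzx addKn; apply/and4P; split; try exact/asboolP; lia.
Qed.

(** A generating set of least cardinality contains every primitive element. *)
Lemma count_primitive_le_embdim (S : set nat) (n : nat) :
  numerical_semigroup S ->
  count (primitive_elt (fun y => `[< S y >])) (iota 0 n) <= embdim S.
Proof.
move=> numS; have [A gA] := numerical_semigroup_fg numS.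
have [|[B [cardB genB]] _] := @leastP [set n | exists A : {fset nat},
    #|` A|%fset = n /\ generated [set` A] = S]%classic.
  by exists #|` A|%fset, A.
rewrite /embdim -cardB -size_filter; apply: uniq_leq_size.
  by rewrite filter_uniq ?iota_uniq.
move=> x; rewrite mem_filter => /andP[px _].
by have := generated_primitive numS.1 genB px.
Qed.

Lemma depth_eq3 (S : set nat) : depth S = Posz 3 ->
  2 * multiplicity S < conductor S <= 3 * multiplicity S.
Proof.
rewrite /depth => q3.
have := real_ceil_itv (num_real ((conductor S)%:Q / (multiplicity S)%:Q)%R).
rewrite q3; have [->|m0] := posnP (multiplicity S).
  (* Inverting 0 gives 0, so the quotient would be 0, whereas a ceiling of 3 needs it above 2. *)
  by rewrite invr0 mulr0.
rewrite ltr_pdivlMr ?ler_pdivrMr ?ltr0z // -!intrM ltr_int ler_int.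
lia.
Qed.

Theorem corollary6p5 (S : set nat) (hS : numerical_semigroup S)
    (hq : depth S = Posz 3) :
  (conductor S <= embdim S * #|` fset_set (left_part S)|%fset)%N.
Proof.
have [[S0 SD] finS] := hS; have /andP[c_gt c_le] := depth_eq3 hq.
have Sc x : conductor S <= x -> S x by exact: conductorP.
have [|[Sm _] m_min] := @leastP (S `\ 0)%classic.
  by exists (conductor S).+1; split=> //; exact: Sc.
rewrite -/(multiplicity S) in Sm m_min.
pose s x := `[< S x >].
apply: (@leq_trans
  (count (primitive_elt s) (iota 0 (conductor S + multiplicity S)) *
   count s (iota 0 (conductor S)))).
  apply: wilf_depth3 => //.
  - exact/asboolP.
  - by move=> x y /asboolP Sx /asboolP Sy; apply/asboolP/SD.
  - exact/asboolP.
  - by move=> x x0 /asboolP Sx; apply: m_min; split=> //= xE; rewrite xE in x0.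
  - by move=> x cx; apply/asboolP/Sc.
apply: leq_mul; first exact: count_primitive_le_embdim.
rewrite -size_filter; apply: size_le_card_fset_set.
- by rewrite filter_uniq ?iota_uniq.
- exact: finite_left_part.
- by move=> x; rewrite mem_filter mem_iota => /andP[/asboolP Sx]; split.
Qed.
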